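(* For each $\rho\in(0,1)$ let $Z_\rho=\frac{\ln(1-\rho)}{\ln\rho}$. Suppose $\eta=\{\eta_k\}_{k=0}^\infty\in\mathbb{H}$ is such that $$\lim_{\rho\uparrow 1}(1-\rho)^{1+\delta}\sum_{k=0}^\infty\eta_k\rho^k=0\quad\text{for all }\delta>0.$$ Then, for all $m\in\mathbb{N}$, $E(X_{\rho,\eta}^m)\sim Z_\rho^m$ as $\rho\uparrow 1$.
   Context: $\mathbb{N}=\{1,2,3,\dots\}$. $f(\rho)\sim g(\rho)$ as $\rho\uparrow1$ means $\lim_{\rho\uparrow1}f(\rho)/g(\rho)=1$. $\mathbb{H}$ is the set of all sequences $\eta=\{\eta_x\}_{x=0}^\infty$ of natural numbers (so $\eta_x\ge 1$ for all $x\ge0$) such that $\sum_{x=0}^\infty\eta_x\rho^x<\infty$ for all $\rho\in(0,1)$. Frog model with drift $\rho$ and frog distribution $\eta$. Fix $\rho\in(0,1)$ and let $p=\frac{1}{1+\rho}\in(\tfrac12,1)$, so that $\rho=\frac{1-p}{p}$; let $\eta\in\mathbb{H}$. At each site $x\in\mathbb{Z}$ with $x\ge 0$ there are initially $\eta_x$ particles (''frogs''), and there are no frogs at sites $x<0$. At time $0$ the $\eta_0$ frogs at the origin are active and all others are sleeping. Active frogs perform, in discrete time, simultaneously and independently of each other, nearest-neighbour random walks on $\mathbb{Z}$, each step being $+1$ with probability $p$ and $-1$ with probability $1-p$. When an active frog visits a site $x$ containing sleeping frogs, all $\eta_x$ of them become active and from then on each performs the same kind of random walk starting from its initial location; all random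 walk transitions are independent. $X_{\rho,\eta}$ denotes a random variable with the distribution of the negative of the minimum of the set of sites visited by active frogs (almost surely finite for $\eta\in\mathbb{H}$). *)

(* Defs.v *)
From mathcomp Require Import all_boot all_order all_algebra.
From mathcomp Require Import all_classical all_reals all_analysis.

Set Implicit Arguments.
Unset Strict Implicit.
Unset Printing Implicit Defensive.
Import Order.TTheory GRing.Theory Num.Theory.
Import numFieldNormedType.Exports.

Local Open Scope classical_set_scope.
Local Open Scope ring_scope.

Definition frog_distribution (R : realType) (eta : nat -> nat) : Prop :=
  (forall x, (0 < eta x)%N) /\
  (forall rho : R, 0 < rho < 1 ->
     cvgn (series (fun x => (eta x)%:R * rho ^+ x))).

Definition mutually_independent d d' (T : measurableType d)
    (S : measurableType d') (R : realType) (P : probability T R)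
    (I : choiceType) (X : I -> {RV P >-> S}) : Prop :=
  forall (s : seq I) (B : I -> set S), uniq s ->
    (forall i, measurable (B i)) ->
    P (\bigcap_(i in [set` s]) (X i @^-1` B i)) =
    (\prod_(i <- s) P (X i @^-1` B i))%E.

(* [Tagged _ i] with [i : 'I_(eta x)] is the i-th frog initially at site x. *)
Definition frog (eta : nat -> nat) : Type := {x : nat & 'I_(eta x)}.

Section trajectories.
Variable eta : nat -> nat.

(* One realization of all the steps: [s f n] is the (n+1)-st step made by the
   frog f, counted from its activation; true is +1 and false is -1. *)
Variable s : frog eta -> nat -> bool.

Definition walk (f : frog eta) (n : nat) : int :=
  (tag f)%:Z + \sum_(i < n) (if s f i then 1 else -1).

(* [age t f] is [None] if the frog f is asleep at time t, and [Some n] if it is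
   active and has made n steps, its position being then [walk f n].  A frog
   that is asleep at time t wakes up at time t+1 exactly when some frog already
   active at time t steps onto its site. *)
Fixpoint age (t : nat) (f : frog eta) : option nat :=
  if t is t'.+1 then
    if age t' f is Some n then Some n.+1
    else if `[< exists g n, age t' g = Some n /\ walk g n.+1 = (tag f)%:Z >]
         then Some 0 else None
  else if tag f == 0%N then Some 0 else None.

Definition visited : set int :=
  [set z | exists t f n, age t f = Some n /\ walk f n = z].

(* The negative of the minimum of the visited sites, +oo if they are unbounded
   below. *)
Definition neg_min (R : realType) : \bar R :=
  (- ereal_inf [set (z%:~R : R)%:E | z in visited])%E.

End trajectories.

(* Each [step f n] equals true (a step +1) with probability p = 1 / (1 + rho),
   hence false (a step -1) with probability 1 - p. *)
Definition frog_steps d (T : measurableType d) (R : realType)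
    (P : probability T R) (eta : nat -> nat) (rho : R)
    (step : frog eta -> nat -> {RV P >-> bool}) : Prop :=
  (forall f n, P (step f n @^-1` [set true]) = ((1 + rho)^-1)%:E) /\
  mutually_independent (fun fn : frog eta * nat => step fn.1 fn.2).

Definition frog_X d (T : measurableType d) (R : realType)
    (P : probability T R) (eta : nat -> nat)
    (step : frog eta -> nat -> {RV P >-> bool}) (w : T) : \bar R :=
  neg_min (fun f n => step f n w) R.

(* E(X^m).  The library expectation only takes real-valued functions, whereas X
   may be +oo on a null event. *)
Definition frog_moment d (T : measurableType d) (R : realType)
    (P : probability T R) (eta : nat -> nat)
    (step : frog eta -> nat -> {RV P >-> bool}) (m : nat) : \bar R :=
  (\int[P]_w (frog_X step w ^+ m))%E.

Definition frog_Z (R : realType) (rho : R) : R := ln (1 - rho) / ln rho.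

(* Main.v *)
(* Every walk drifts to the right, so every frog eventually wakes up and X is at
   least k exactly when some frog, awake or not, has a trajectory hitting -k; for
   a frog starting at x this has probability rho^(x + k).
   Above: by the union bound P(X >= k) <= rho^k A with A = sum_x eta_x rho^x, and
   since rho^Z = 1 - rho, the hypothesis on eta makes rho^K A negligible for
   K = (1 + delta) Z; as 1 / (1 - rho) = o(Z), the layers above K contribute a
   negligible part of E(X^m).
   Below: keeping one frog per site and using independence,
   P(X < k) <= prod_x (1 - rho^(x + k)) <= 1 / (1 + rho^k / (1 - rho)), which tends
   to 0 for k = (1 - delta) Z. *)
Require Import Defs.
From mathcomp Require Import all_boot all_order all_algebra.
From mathcomp Require Import all_classical all_reals all_analysis.
From mathcomp Require Import measurable_realfun.
From mathcomp Require Import zify ring lra.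
Import Order.TTheory GRing.Theory Num.Theory.
Import numFieldNormedType.Exports.
Local Open Scope classical_set_scope.
Local Open Scope ring_scope.

Set Implicit Arguments.
Unset Strict Implicit.
Unset Printing Implicit Defensive.

(** * Levels reached within finitely many steps *)

(* [hit c b N n j]: with the [N] steps [b n, ..., b (n + N - 1)], a walker gets
   [j] sites further in direction [c] (upwards if [c] is true). *)
Fixpoint hit (c : bool) (b : nat -> bool) (N n j : nat) : bool :=
  match j, N with
  | 0, _ => true
  | _.+1, 0 => false
  | j'.+1, N'.+1 => hit c b N' n.+1 (if b n == c then j' else j.+1)
  end.

Lemma hitS c b N n j : hit c b N.+1 n j.+1 =
  if b n == c then hit c b N n.+1 j else hit c b N n.+1 j.+2.
Proof. by rewrite /=; case: ifP. Qed.

Lemma hit_dist0 c b N n : hit c b N n 0. Proof. by case: N. Qed.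

Lemma hit_horizon c b N N' n j : (N <= N')%N -> hit c b N n j -> hit c b N' n j.
Proof.
elim: N N' n j => [|N IH] N' n [|j] //; rewrite ?hit_dist0 //.
by case: N' => // N' le_N; rewrite !hitS; case: ifP => _; exact: IH.
Qed.

Lemma hit_nearer c b N n j j' : (j' <= j)%N -> hit c b N n j -> hit c b N n j'.
Proof.
elim: N n j j' => [|N IH] n [|j] [|j'] //; rewrite ?hit_dist0 //.
by move=> le_j; rewrite !hitS; case: ifP => _; apply: IH.
Qed.

(** * Trajectories, awakenings and visited sites *)

Section trajectory.
Variables (eta : nat -> nat) (s : frog eta -> nat -> bool).

Lemma walkS f n : walk s f n.+1 = walk s f n + (if s f n then 1 else -1).
Proof. by rewrite /walk big_ord_recr addrA. Qed.

Lemma hit_down_walk f N n j : hit false (s f) N n j ->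
  exists n', walk s f n' = walk s f n - j%:Z.
Proof.
elim: N n j => [|N IH] n [|j] //; try by move=> _; exists n; rewrite subr0.
rewrite hitS; case sn: (s f n) => /= /IH[n' e]; exists n';
  by rewrite e walkS sn; lia.
Qed.

Lemma hit_up_walk f N n j : hit true (s f) N n j ->
  exists n', walk s f n' = walk s f n + j%:Z.
Proof.
elim: N n j => [|N IH] n [|j] //; try by move=> _; exists n; rewrite addr0.
rewrite hitS; case sn: (s f n) => /= /IH[n' e]; exists n';
  by rewrite e walkS sn; lia.
Qed.

(** Steps have size one, so a walk that ends at or below a level has passed through it. *)
Lemma walk_hit_down f N n j :
  walk s f (n + N) <= walk s f n - j%:Z -> hit false (s f) N n j.
Proof.
elim: N n j => [|N IH] n [|j]; rewrite ?hit_dist0 //; first by rewrite addn0; lia.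
rewrite hitS -addSnnS => le_w; have := walkS f n.
by case sn: (s f n) => /= ?; apply: IH; lia.
Qed.

Lemma walk0 f : walk s f 0 = (tag f)%:Z.
Proof. by rewrite /walk big_ord0 addr0. Qed.

Lemma age_later t f n k : age s t f = Some n -> age s (t + k) f = Some (n + k)%N.
Proof.
move=> e; elim: k => [|k IH]; first by rewrite !addn0.
by rewrite !addnS /= IH.
Qed.

Lemma age_Some0 t f n : age s t f = Some n -> exists t0, age s t0 f = Some 0.
Proof.
elim: t n => [|t IH] n; first by move=> /= e; exists 0; move: e => /=; case: ifP.
move=> /= e; case e': (age s t f) => [k|]; first exact: IH e'.
exists t.+1; move: e; rewrite /= e'; by case: ifP.
Qed.

(** An awake frog once had age 0, and from that moment on it goes through its whole trajectory; so
    [k] is unrelated to the age [n]. *)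
Lemma walk_visited t f n k : age s t f = Some n -> visited s (walk s f k).
Proof.
move=> /age_Some0[t0 /(age_later k)]; rewrite add0n => e.
by exists (t0 + k)%N, f, k.
Qed.

Lemma origin_awake f : tag f = 0%N -> age s 0 f = Some 0%N.
Proof. by move=> /= ->. Qed.

Lemma visit_wakes g f t0 k n :
  age s t0 g = Some k -> walk s g n = (tag f)%:Z -> exists t m, age s t f = Some m.
Proof.
move=> /age_Some0[t1 ag0]; case: n => [|n] e.
  (* For [n = 0] the two frogs start at the same site, so whatever woke [g] wakes [f] as well,
     unless [f] was awake before. *)
  elim: t1 ag0 => [|t1 IH].
    move=> /=; case: eqP => // tg _; exists 0%N, 0%N => /=.
    by move: e; rewrite walk0 tg => -[<-].
  move=> /=; case: (age s t1 g) => // ; case: ifP => // /asboolP [h [q [ah wh]]] _.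
  case ef: (age s t1 f) => [m|]; first by exists t1, m.
  exists t1.+1, 0%N => /=; rewrite ef.
  case: ifP => // /asboolP[]; exists h, q; split => //.
  by rewrite wh -e walk0.
have agn := age_later n ag0; rewrite add0n in agn.
case ef: (age s (t1 + n) f) => [m|]; first by exists (t1 + n)%N, m.
exists (t1 + n).+1, 0%N => /=; rewrite ef.
by case: ifP => // /asboolP[]; exists g, n.
Qed.

Lemma visited_walk z : visited s z -> exists f n, walk s f n = z.
Proof. by case=> t [f [n [_ e]]]; exists f, n. Qed.

End trajectory.

(** * Bounds on finite-horizon hitting probabilities *)

Section hitting_probability.
Variable R : realType.
Implicit Types q r a beta gamma : R.

(* Probability of [hit] when each step is towards the target with probability [q]. *)
Fixpoint hit_prob q (N j : nat) : R :=
  match j, N with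
  | 0, _ => 1
  | _.+1, 0 => 0
  | j'.+1, N'.+1 => q * hit_prob q N' j' + (1 - q) * hit_prob q N' j.+1
  end.

Lemma hit_probS q N j : hit_prob q N.+1 j.+1 = q * hit_prob q N j + (1 - q) * hit_prob q N j.+2.
Proof. by []. Qed.

Lemma hit_prob_dist0 q N : hit_prob q N 0 = 1. Proof. by case: N. Qed.

Lemma hit_prob_ge0 q N j : 0 <= q <= 1 -> 0 <= hit_prob q N j.
Proof.
case/andP=> q0 q1; elim: N j => [|N IH] [|j] //=.
by rewrite addr_ge0 // mulr_ge0 ?subr_ge0.
Qed.

(** The equation for [r] says that [r ^+ j] satisfies the recursion of [hit_prob] exactly; since it
    dominates at horizon 0, it dominates at every horizon. *)
Lemma hit_prob_le q r N j : 0 <= q <= 1 -> 0 <= r -> q + (1 - q) * r ^+ 2 = r ->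
  hit_prob q N j <= r ^+ j.
Proof.
case/andP=> q0 q1 r0 er; elim: N j => [|N IH] [|j] //=; first exact: exprn_ge0.
have -> : r ^+ j.+1 = q * r ^+ j + (1 - q) * r ^+ j.+2.
  by rewrite exprSr -[X in _ * X]er !exprS; ring.
by rewrite lerD // ler_wpM2l ?subr_ge0.
Qed.

(* [r ^+ j] is harmonic for the walk, and the correction is superharmonic with
   a rate [beta] that can be taken smaller than 1 whenever [gamma] lies strictly
   between the two solutions [q / (1 - q)] and [1] of the equation for [r]. *)
Lemma hit_prob_ge q r beta gamma N j : 0 <= q <= 1 -> 0 <= r <= gamma -> 0 <= beta ->
  q + (1 - q) * r ^+ 2 = r -> q + (1 - q) * gamma ^+ 2 <= beta * gamma ->
  r ^+ j - beta ^+ N * gamma ^+ j <= hit_prob q N j.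
Proof.
case/andP=> q0 q1 /andP[r0 rg] b0 er eg.
have g0 := le_trans r0 rg.
elim: N j => [|N IH] [|j] //=.
- by rewrite !expr0; lra.
- by rewrite expr0 mul1r subr_le0 lerXn2r.
- by rewrite expr0 mulr1 gerBl exprn_ge0.
have -> : r ^+ j.+1 = q * r ^+ j + (1 - q) * r ^+ j.+2.
  by rewrite exprSr -[X in _ * X]er !exprS; ring.
apply: (@le_trans _ _ (q * (r ^+ j - beta ^+ N * gamma ^+ j) +
   (1 - q) * (r ^+ j.+2 - beta ^+ N * gamma ^+ j.+2))); last first.
  by rewrite lerD // ler_wpM2l ?subr_ge0.
have h : 0 <= beta ^+ N * gamma ^+ j * (beta * gamma - (q + (1 - q) * gamma ^+ 2)).
  by rewrite mulr_ge0 ?subr_ge0 // mulr_ge0 // exprn_ge0.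
have -> : beta ^+ N.+1 * gamma ^+ j.+1 = beta ^+ N * gamma ^+ j * (beta * gamma).
  by rewrite !exprS; ring.
rewrite !exprS; rewrite expr2 in h.
rewrite -subr_ge0.
by apply: le_trans h _; rewrite le_eqVlt; apply/orP; left; apply/eqP; ring.
Qed.

End hitting_probability.

(** * Independence of the frogs *)

Section independence.
Variables (d : measure_display) (T : measurableType d) (R : realType).
Variables (P : probability T R) (eta : nat -> nat) (rho : R).
Variable step : frog eta -> nat -> {RV P >-> bool}.
Hypotheses (rho01 : 0 < rho < 1) (steps : frog_steps rho step).
Implicit Types (s : seq (frog eta * nat)) (A : set T) (f : frog eta) (c : bool).

Definition toward_prob c : R := if c then (1 + rho)^-1 else rho / (1 + rho).

Lemma toward_prob01 c : 0 <= toward_prob c <= 1.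
Proof.
case/andP: rho01 => r0 r1; have h : 0 < 1 + rho by lra.
by case: c => /=; rewrite ?invr_ge0 ?divr_ge0 ?(ltW h) ?(ltW r0) //=;
  rewrite ?invf_le1 ?ler_pdivrMr ?mul1r //; lra.
Qed.

Lemma toward_probN c : toward_prob (~~ c) = 1 - toward_prob c.
Proof.
case/andP: rho01 => r0 r1; have h : 1 + rho != 0 by apply: lt0r_neq0; lra.
by case: c => /=; field.
Qed.

Lemma measurable_step f n (B : set bool) : measurable (step f n @^-1` B).
Proof. by rewrite -[X in measurable X]setTI; apply: measurable_funP. Qed.

Lemma step_prob f n c : P (step f n @^-1` [set c]) = (toward_prob c)%:E.
Proof.
case: c; first by rewrite (steps.1 f n).
have -> : step f n @^-1` [set false] = ~` (step f n @^-1` [set true]).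
  by apply/seteqP; split => w /=; case: (step f n w).
rewrite probability_setC ?(steps.1 f n); last exact: measurable_step.
by rewrite -EFinB; congr EFin; rewrite (toward_probN true).
Qed.

(** Only rectangles over finitely many steps: these are the events for which independence gives a
    product directly, and the class is stable under revealing one more step. *)
Definition cylinder s A := exists B : frog eta * nat -> set bool,
  A = \bigcap_(i in [set` s]) (step i.1 i.2 @^-1` B i).

Lemma cylinder_measurable s A : cylinder s A -> measurable A.
Proof.
case=> B ->; apply: fin_bigcap_measurable; first exact: finite_seq.
by move=> i _; exact: measurable_step.
Qed.

Lemma cylinder_prob s A : uniq s -> cylinder s A -> exists B : frog eta * nat -> set bool,
  A = \bigcap_(i in [set` s]) (step i.1 i.2 @^-1` B i) /\
  P A = (\prod_(i <- s) P (step i.1 i.2 @^-1` B i))%E.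
Proof.
by move=> us [B eA]; exists B; split => //; rewrite eA (steps.2 s B us).
Qed.

Lemma cylinder_cons s A f n c : uniq s -> (f, n) \notin s -> cylinder s A ->
  cylinder ((f, n) :: s) (A `&` step f n @^-1` [set c]) /\
  P (A `&` step f n @^-1` [set c]) = (P A * (toward_prob c)%:E)%E.
Proof.
move=> us ns /(cylinder_prob us)[B [eA pA]].
pose B' i := if i == (f, n) then [set c] else B i.
have B'E i : i \in s -> B' i = B i.
  by rewrite /B'; case: eqP => // -> h; rewrite h in ns.
have e : A `&` step f n @^-1` [set c] =
    \bigcap_(i in [set` (f, n) :: s]) (step i.1 i.2 @^-1` B' i).
  rewrite eA; apply/seteqP; split => w /=.
    move=> [h1 h2] i /=; rewrite inE => /orP[/eqP ->|si].
      by rewrite /B' eqxx.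
    by rewrite B'E //; exact: h1.
  move=> h; split; last by have := h (f, n); rewrite /B' /= eqxx; apply; exact: mem_head.
  by move=> i /= si; rewrite -B'E //; apply: h => /=; rewrite inE si orbT.
split; first by exists B'.
rewrite e (steps.2 _ B') /=; last 2 first.
- by rewrite ns.
- by [].
rewrite big_cons /= {1}/B' eqxx step_prob muleC; congr (_ * _)%E.
by rewrite pA; apply: eq_big_seq => i /= si; rewrite B'E.
Qed.

Definition miss c N n j f := [set w | ~~ hit c (fun k => step f k w) N n j].

Definition all_miss c N (J : frog eta -> nat) (fs : seq (frog eta)) :=
  [set w | all (fun f => ~~ hit c (fun k => step f k w) N 0 (J f)) fs].

Lemma miss_dist0 c N n f : miss c N n 0 f = set0.
Proof. by apply/seteqP; split => // w; rewrite /miss /= hit_dist0. Qed.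

Lemma miss_horizon0 c n j f : miss c 0 n j.+1 f = setT.
Proof. by apply/seteqP; split. Qed.

Lemma missS c N n j f : miss c N.+1 n j.+1 f =
  (step f n @^-1` [set c] `&` miss c N n.+1 j f) `|`
  (step f n @^-1` [set ~~ c] `&` miss c N n.+1 j.+2 f).
Proof.
apply/seteqP; split => w; rewrite /miss [mkset]/mkset hitS.
  case: eqP => [e|e] h; [left|right]; split => //=.
  by case: (c) e; case: (step f n w).
move=> [] [] /= ->; first by rewrite eqxx.
by case: ifP => //; case: (c).
Qed.

Lemma measurable_miss c N n j f : measurable (miss c N n j f).
Proof.
elim: N n j => [|N IH] n [|j]; rewrite ?miss_dist0 ?miss_horizon0 //.
by rewrite missS; apply: measurableU; apply: measurableI => //;
  exact: measurable_step.
Qed.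

Lemma all_miss_cons c N J f fs :
  all_miss c N J (f :: fs) = miss c N 0 (J f) f `&` all_miss c N J fs.
Proof. by apply/seteqP; split => w /= /andP. Qed.

Lemma measurable_all_miss c N J fs : measurable (all_miss c N J fs).
Proof.
elim: fs => [|f fs IH].
  by rewrite (_ : all_miss _ _ _ _ = setT) //; apply/seteqP; split.
by rewrite all_miss_cons; apply: measurableI => //; exact: measurable_miss.
Qed.

(* Joint independence of the frogs, by revealing one step at a time: the steps
   already revealed are recorded in the cylinder [A]. *)
Lemma cylinder_all_miss c N J fs s A :
  uniq fs -> uniq s -> (forall i, i \in s -> i.1 \notin fs) -> cylinder s A ->
  P (A `&` all_miss c N J fs) =
    (P A * (\prod_(f <- fs) (1 - hit_prob (toward_prob c) N (J f)))%:E)%E.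
Proof.
elim: fs s A => [|f fs IH] s A.
  move=> _ _ _ _; rewrite big_nil mule1 (_ : all_miss _ _ _ _ = setT) ?setIT //.
  by apply/seteqP; split.
move=> /= /andP[nf ufs] us sfs cA.
(* Inner induction on the remaining horizon [M] of the first frog. All its revealed steps have index
   below [n], so step [n] is fresh and splitting on it reproduces the recursion of [hit_prob]. *)
have main M : forall n j s A, uniq s ->
    (forall i, i \in s -> i.1 \notin fs) ->
    (forall k, (f, k) \in s -> (k < n)%N) -> cylinder s A ->
    P (A `&` (miss c M n j f `&` all_miss c N J fs)) =
    (P A * ((1 - hit_prob (toward_prob c) M j) * \prod_(g <- fs) (1 - hit_prob (toward_prob c) N (J g)))%:E)%E.
  elim: M => [|M IHM] n j {}s {}A {}us {}sfs sn {}cA.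
    case: j => [|j].
      by rewrite miss_dist0 set0I setI0 measure0 hit_prob_dist0 subrr mul0r mule0.
    by rewrite miss_horizon0 setTI (IH s) //= subr0 mul1r.
  case: j => [|j].
    by rewrite miss_dist0 set0I setI0 measure0 hit_prob_dist0 subrr mul0r mule0.
  have ns : (f, n) \notin s by apply/negP => /sn; rewrite ltnn.
  have [cA1 pA1] := cylinder_cons c us ns cA.
  have [cA2 pA2] := cylinder_cons (~~ c) us ns cA.
  have us' : uniq ((f, n) :: s) by rewrite /= ns.
  have sfs' i : i \in (f, n) :: s -> i.1 \notin fs.
    by rewrite inE => /orP[/eqP ->|/sfs].
  have sn' k : (f, k) \in (f, n) :: s -> (k < n.+1)%N.
    by rewrite inE => /orP[/eqP[->]|/sn /ltnW].
  have -> : A `&` (miss c M.+1 n j.+1 f `&` all_miss c N J fs) =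
      A `&` step f n @^-1` [set c] `&` (miss c M n.+1 j f `&` all_miss c N J fs) `|`
      A `&` step f n @^-1` [set ~~ c] `&`
        (miss c M n.+1 j.+2 f `&` all_miss c N J fs).
    by rewrite missS setIUl setIUr !setIA.
  transitivity (
      P (A `&` step f n @^-1` [set c] `&` (miss c M n.+1 j f `&` all_miss c N J fs)) +
      P (A `&` step f n @^-1` [set ~~ c] `&`
        (miss c M n.+1 j.+2 f `&` all_miss c N J fs)))%E.
    apply: measureU.
    - apply: measurableI; first exact: cylinder_measurable cA1.
      by apply: measurableI; [exact: measurable_miss|exact: measurable_all_miss].
    - apply: measurableI; first exact: cylinder_measurable cA2.
      by apply: measurableI; [exact: measurable_miss|exact: measurable_all_miss].
    - apply/seteqP; split => // w [[[_ /= e1] _] [[_ /= e2] _]].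
      by move: e2; rewrite e1; case: (c).
  have -> := IHM n.+1 j _ _ us' sfs' sn' cA1.
  have -> := IHM n.+1 j.+2 _ _ us' sfs' sn' cA2.
  rewrite pA1 pA2 hit_probS toward_probN.
  have mA := cylinder_measurable cA.
  rewrite -(fineK (fin_num_measure P A mA)) -!EFinM -EFinD; congr EFin; ring.
rewrite all_miss_cons big_cons; apply: (main _ _ _ s) => //.
- by move=> i /sfs; rewrite inE negb_or => /andP[].
- by move=> k /sfs; rewrite inE eqxx.
Qed.

Lemma all_miss_prob c N J fs : uniq fs ->
  P (all_miss c N J fs) = (\prod_(f <- fs) (1 - hit_prob (toward_prob c) N (J f)))%:E.
Proof.
move=> ufs.
have cT : cylinder [::] setT.
  by exists (fun=> setT); apply/esym/seteqP; split => // w _ i.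
by rewrite -[all_miss _ _ _ _]setTI (cylinder_all_miss _ _ _ ufs _ _ cT) //
  probability_setT mul1e.
Qed.

Lemma miss_prob c N j f : P (miss c N 0 j f) = (1 - hit_prob (toward_prob c) N j)%:E.
Proof.
have := @all_miss_prob c N (fun=> j) [:: f] isT.
rewrite big_seq1 => <-; congr (P _); apply/seteqP; split => w;
  by rewrite /all_miss /= andbT.
Qed.

End independence.

(** * Moments from a geometric tail bound *)

Section moment_tail.
Variable R : realType.

(** This is the sum of i! / k! over k <= i, the constant produced by [i] successive summations by
    parts. *)
Fixpoint tail_const (i : nat) : R :=
  if i is i'.+1 then 1 + i%:R * tail_const i' else 1.

Lemma tail_const_ge0 i : 0 <= tail_const i.
Proof. by elim: i => //= i IH; rewrite addr_ge0 // mulr_ge0. Qed.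

Lemma expr_incr_le (x : R) i : 0 <= x ->
  (x + 1) ^+ i.+1 - x ^+ i.+1 <= i.+1%:R * (x + 1) ^+ i.
Proof.
move=> x0; elim: i => [|i IH]; first by rewrite !expr1 expr0; lra.
have -> : (x + 1) ^+ i.+2 - x ^+ i.+2 =
    (x + 1) * ((x + 1) ^+ i.+1 - x ^+ i.+1) + x ^+ i.+1.
  by rewrite ![_ ^+ i.+2]exprS; ring.
have -> : i.+2%:R * (x + 1) ^+ i.+1 =
    (x + 1) * (i.+1%:R * (x + 1) ^+ i) + (x + 1) ^+ i.+1.
  by rewrite -[in LHS]natr1 exprS; ring.
apply: lerD; first by rewrite ler_wpM2l //; lra.
by rewrite lerXn2r ?nnegrE //; lra.
Qed.

Lemma abel_summation (b : nat -> R) r n :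
  (1 - r) * (\sum_(j < n) b j * r ^+ j) + b n * r ^+ n =
  b 0 + \sum_(j < n) (b j.+1 - b j) * r ^+ j.+1.
Proof.
elim: n => [|n IH]; first by rewrite !big_ord0 mulr0 expr0 mulr1 add0r addr0.
by rewrite !big_ord_recr /= addrA -IH exprS; ring.
Qed.

(** Each Abel summation trades one power of [W + j] for a factor [i / (1 - r)], and
    [(1 - r)^-1 <= W] turns that factor back into a power of [W]. *)
Lemma sum_expr_geometric_le (r W : R) i n : 0 <= r < 1 -> (1 - r)^-1 <= W ->
  \sum_(j < n) (W + j%:R) ^+ i * r ^+ j <= tail_const i * (1 - r)^-1 * W ^+ i.
Proof.
case/andP=> r0 r1 uW.
have h1 : 0 < 1 - r by lra.
have u0 : 0 < (1 - r)^-1 by rewrite invr_gt0.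
have W0 : 0 <= W by apply: le_trans uW; exact: ltW.
elim: i n => [|i IH] n; rewrite -(ler_pM2l h1) -mulrA mulrCA (mulrA (1 - r)) divff ?gt_eqF // mul1r.
  have := abel_summation (fun=> 1) r n.
  rewrite [X in _ = _ + X]big1 => [|j _]; last by rewrite subrr mul0r.
  have := exprn_ge0 n r0.
  under [in X in _ -> X -> _]eq_bigr do rewrite mul1r.
  under [in X in _ -> _ -> X]eq_bigr do rewrite expr0 mul1r.
  by rewrite expr0 /=; lra.
have := abel_summation (fun j => (W + j%:R) ^+ i.+1) r n.
set S := \sum_(j < n) _; set S' := \sum_(j < n) _ => e.
have b0 : 0 <= (W + n%:R) ^+ i.+1 * r ^+ n.
  by rewrite mulr_ge0 ?exprn_ge0 // addr_ge0.
have S'le : S' <= i.+1%:R * (tail_const i * (1 - r)^-1 * W ^+ i).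
  (* The increments are bounded by powers of [W + j + 1], a shift by one; hence [n.+1] terms, the
     first of which is dropped. *)
  apply: le_trans (ler_wpM2l (ler0n _ _) (IH n.+1)).
  rewrite big_ord_recl /= mulrDr -[S']add0r lerD //.
    by rewrite mulr_ge0 // mulr_ge0 ?exprn_ge0 ?addr_ge0.
  rewrite mulr_sumr; apply: ler_sum => j _; rewrite mulrA.
  rewrite ler_wpM2r ?exprn_ge0 //= /bump /= add1n -natr1 addrA.
  by apply: expr_incr_le; rewrite addr_ge0.
have Sle : (1 - r) * S <= W ^+ i.+1 + S'.
  by move: e; rewrite addr0 => <-; lra.
apply: le_trans Sle _ => /=.
rewrite mulrDl mul1r lerD2l.
apply: le_trans S'le _; rewrite -!mulrA ler_wpM2l // ler_wpM2l ?tail_const_ge0 //.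
by rewrite exprS ler_wpM2r ?exprn_ge0.
Qed.

(** The increment of the [m]-th power is at most [m] times an [(m - 1)]-st power, so the geometric
    estimate applies with [W = K + 1]. *)
Lemma tail_sum_le (r A : R) m K n : 0 <= r < 1 -> 0 <= A ->
  (1 - r)^-1 <= K.+1%:R ->
  \sum_(j < n) ((K + j.+1)%:R ^+ m - (K + j)%:R ^+ m) * (A * r ^+ (K + j.+1)) <=
  K.+1%:R ^+ m * (A * r ^+ K * tail_const m).
Proof.
move=> /[dup] r01 /andP[r0 r1] A0 uW.
have AK : 0 <= A * r ^+ K by rewrite mulr_ge0 ?exprn_ge0.
case: m => [|m].
  rewrite big1 => [|j _]; last by rewrite !expr0 subrr mul0r.
  by rewrite mulr_ge0 ?exprn_ge0 // mulr_ge0.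
apply: (@le_trans _ _ (\sum_(j < n)
    A * r ^+ K * (m.+1%:R * ((K.+1%:R + j%:R) ^+ m * r ^+ j)))).
  apply: ler_sum => j _.
  have rj : r ^+ (K + j.+1) <= r ^+ K * r ^+ j.
    rewrite -exprD addnS exprS -[leRHS]mul1r ler_wpM2r ?exprn_ge0 //; exact: ltW.
  have := @expr_incr_le (K + j)%:R m (ler0n _ _).
  rewrite natr1 -addnS -natrD addSnnS => h.
  have -> : A * r ^+ K * (m.+1%:R * ((K + j.+1)%:R ^+ m * r ^+ j)) =
      (m.+1%:R * (K + j.+1)%:R ^+ m) * (A * (r ^+ K * r ^+ j)) by ring.
  apply: ler_pM => //.
  - by rewrite subr_ge0 lerXn2r ?nnegrE ?ler0n // ler_nat addnS.
  - by rewrite mulr_ge0 ?exprn_ge0.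
  - by rewrite ler_wpM2l.
rewrite -mulr_sumr -mulr_sumr.
have := sum_expr_geometric_le m n r01 uW; set S := \sum_(j < n) _ => h.
rewrite [leRHS]mulrCA ler_wpM2l //.
apply: (@le_trans _ _ (m.+1%:R * (tail_const m * (1 - r)^-1 * K.+1%:R ^+ m))).
  by rewrite ler_wpM2l.
apply: (@le_trans _ _ (m.+1%:R * tail_const m * K.+1%:R ^+ m.+1)).
  rewrite -!mulrA ler_wpM2l // ler_wpM2l ?tail_const_ge0 //.
  by rewrite exprS ler_wpM2r ?exprn_ge0.
by rewrite mulrC /= ler_wpM2l ?exprn_ge0 // lerDr.
Qed.

Section integral.
Variables (d : measure_display) (T : measurableType d) (P : probability T R).
Local Open Scope ereal_scope.

(* No measurability is required of [f], so that the moment of [X] can be bounded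
   above without showing that [X] is measurable. *)
Lemma le_integral_nonneg (f g : T -> \bar R) : (forall x, 0 <= f x) ->
  (forall x, f x <= g x) -> \int[P]_x f x <= \int[P]_x g x.
Proof.
move=> f0 fg; have g0 x : 0 <= g x := le_trans (f0 x) (fg x).
rewrite !ge0_integralTE //; apply: ge_ereal_sup => _ [h hf <-].
by apply: ereal_sup_ubound; exists h => // x; exact: le_trans (hf x) (fg x).
Qed.

Lemma lee_expe (x y : \bar R) n : 0 <= x -> x <= y -> x ^+ n <= y ^+ n.
Proof.
move=> x0 xy; elim: n => [|n IH]; first by rewrite !expe0.
by rewrite !expeS; apply: lee_pmul => //; exact: expe_ge0.
Qed.

Variables (X : T -> \bar R) (E : nat -> set T) (A r : R).
Hypotheses (r01 : (0 <= r < 1)%R) (A0 : (0 <= A)%R).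
Hypotheses (mE : forall k, measurable (E k))
  (PE : forall k, P (E k) <= (A * r ^+ k)%:E).
Hypothesis X0 : forall w, 0 <= X w.
(** The second alternative accommodates the points where [X w] is infinite. *)
Hypothesis XE : forall w,
  (exists2 n, X w <= n%:R%:E & forall k, (0 < k <= n)%N -> E k w) \/
  (forall k, E k w).

Let incr m K j : R := ((K + j.+1)%:R ^+ m - (K + j)%:R ^+ m)%R.

Let incr_ge0 m K j : (0 <= incr m K j)%R.
Proof. by rewrite subr_ge0 lerXn2r ?nnegrE ?ler0n // ler_nat addnS. Qed.

Lemma moment_layers m K w : (0 < m)%N ->
  X w ^+ m <= (K%:R ^+ m)%:E +
    \sum_(0 <= j <oo) (incr m K j)%:E * (\1_(E (K + j.+1)) w)%:E.
Proof.
move=> m0; set S := \sum_(_ <= _ <oo) _.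
have t0 j : 0 <= (incr m K j)%:E * (\1_(E (K + j.+1)) w)%:E.
  by rewrite mule_ge0 ?lee_fin.
have S0 : 0 <= S by exact: nneseries_ge0.
(* Layer cake: [n ^ m - K ^ m] telescopes into the increments of the layers between [K] and [n], all
   of whose indicators are 1. *)
have partial n : (forall k, (K < k <= n)%N -> E k w) ->
    (n%:R ^+ m)%:E <= (K%:R ^+ m)%:E + S.
  move=> En; have [nK|Kn] := leqP n K.
    apply: (@le_trans _ _ (K%:R ^+ m)%:E); last by rewrite leeDl.
    by rewrite lee_fin lerXn2r ?nnegrE ?ler0n // ler_nat.
  apply: (@le_trans _ _ ((K%:R ^+ m)%:E +
      \sum_(0 <= j < n - K) (incr m K j)%:E * (\1_(E (K + j.+1)) w)%:E)); last first.
    by rewrite leeD2l //; apply: nneseries_lim_ge.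
  rewrite big_nat (eq_bigr (fun j => (incr m K j)%:E)) => [|j /= jn]; last first.
    by rewrite indicE mem_set ?mule1 //; apply: En; lia.
  rewrite -big_nat sumEFin -EFinD lee_fin.
  rewrite (telescope_sumr_eq (fun j => (K + j)%:R ^+ m)%R) //.
  by rewrite addn0 subnKC ?(ltnW Kn) // addrC subrK.
case: (XE w) => [[n Xn En]|En].
  apply: le_trans (partial n _); last by move=> k kn; apply: En; lia.
  by rewrite EFin_expe; exact: lee_expe.
(* If all layers occur, the right-hand side exceeds every integer and is therefore [+oo]. *)
have : forall n, n%:R%:E <= (K%:R ^+ m)%:E + S.
  move=> n; apply: le_trans (partial n _) => //.
  rewrite lee_fin; case: n => [|n]; first exact: exprn_ge0.
  by rewrite -natrX ler_nat -[X in (X <= _)%N]expn1 leq_pexp2l.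
case: ((K%:R ^+ m)%:E + S) => [x|_|/(_ 0%N)] //; last by rewrite leey.
move=> /(_ (Num.truncn x).+1); rewrite lee_fin => h.
by have := truncnS_gt x; rewrite ltNge h.
Qed.

Lemma moment_le m K : (0 < m)%N -> ((1 - r)^-1 <= K.+1%:R)%R ->
  \int[P]_w (X w ^+ m) <=
    (K.+1%:R ^+ m * (1 + A * r ^+ K * tail_const m))%:E.
Proof.
move=> m0 uK.
apply: (@le_trans _ _ (\int[P]_w ((K%:R ^+ m)%:E +
    \sum_(0 <= j <oo) (incr m K j)%:E * (\1_(E (K + j.+1)) w)%:E))).
  apply: le_integral_nonneg => w; first exact: expe_ge0.
  exact: moment_layers.
have t0 j w : 0 <= (incr m K j)%:E * (\1_(E (K + j.+1)) w)%:E.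
  by rewrite mule_ge0 ?lee_fin.
have tm j : measurable_fun setT
    (fun w => (incr m K j)%:E * (\1_(E (K + j.+1)) w)%:E).
  by apply: measurable_funeM; apply/measurable_EFinP; exact: measurable_indic.
rewrite ge0_integralD //; last 2 first.
- by move=> w _; exact: nneseries_ge0.
- by apply: (ge0_emeasurable_sum (P := predT)) => // j.
have -> : \int[P]_w (K%:R ^+ m)%:E = (K%:R ^+ m)%:E.
  have := integral_cst P measurableT (K%:R ^+ m)%:E; rewrite /cst => ->.
  exact: etrans (congr1 _ (probability_setT P)) (mule1 _).
rewrite integral_nneseries //.
rewrite mulrDr mulr1 EFinD leeD //.
  by rewrite lee_fin lerXn2r ?nnegrE ?ler0n // ler_nat.
apply: lime_le; first by apply: is_cvg_nneseries => j _ _; exact: integral_ge0.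
apply: nearW => n.
apply: (@le_trans _ _
    (\sum_(0 <= j < n) ((incr m K j * (A * r ^+ (K + j.+1)))%R)%:E)).
  apply: lee_sum => j _.
  rewrite ge0_integralZl_EFin //; last first.
    by apply/measurable_EFinP; exact: measurable_indic.
  rewrite integral_indic // setIT EFinM; apply: lee_wpmul2l; last exact: PE.
  by rewrite lee_fin.
by rewrite sumEFin lee_fin big_mkord; exact: tail_sum_le.
Qed.

End integral.
End moment_tail.

(** * The lowest visited site: union bound above, finite-horizon bound below *)

Section moment_bounds.
Variables (d : measure_display) (T : measurableType d) (R : realType).
Variables (P : probability T R) (eta : nat -> nat) (rho : R).
Variable step : frog eta -> nat -> {RV P >-> bool}.
Hypotheses (rho01 : 0 < rho < 1) (steps : frog_steps rho step).
Hypothesis eta_gt0 : forall x, (0 < eta x)%N.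
Hypothesis eta_cvg : cvgn (series (fun x => (eta x)%:R * rho ^+ x)).

Let weight : R := limn (series (fun x => (eta x)%:R * rho ^+ x)).

Let bits w (f : frog eta) n := step f n w.

Definition frogs_before N : seq (frog eta) :=
  [seq Tagged (fun x => 'I_(eta x)) i | x <- iota 0 N, i <- enum 'I_(eta x)].

Lemma uniq_frogs_before N : uniq (frogs_before N).
Proof.
apply: allpairs_uniq_dep; first exact: iota_uniq.
  by move=> x _; exact: enum_uniq.
by move=> [x i] [y j] _ _ /=.
Qed.

Lemma mem_frogs_before f N : (tag f < N)%N -> f \in frogs_before N.
Proof.
case: f => x i /= xN; apply/allpairsPdep; exists x, i; split => //.
  by rewrite mem_iota.
by rewrite mem_enum.
Qed.

(** One [N] cuts off both the number of steps and the starting sites, so the event involves finitely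
    many frogs and increases with [N]. *)
Definition reached k N : set T :=
  ~` all_miss step false N (fun f => tag f + k)%N (frogs_before N).

Lemma measurable_reached k N : measurable (reached k N).
Proof. by apply: measurableC; exact: measurable_all_miss. Qed.

Lemma prod_onem_bounds (I : Type) (s : seq I) (h : I -> R) :
  (forall i, 0 <= h i <= 1) ->
  1 - \sum_(i <- s) h i <= \prod_(i <- s) (1 - h i) <= 1.
Proof.
move=> h01; elim: s => [|i s /andP[IH1 IH2]]; first by rewrite !big_nil subr0 lexx.
rewrite !big_cons; case/andP: (h01 i) => h0 h1.
have p0 : 0 <= \prod_(j <- s) (1 - h j).
  by apply: prodr_ge0 => j _; rewrite subr_ge0; case/andP: (h01 j).
by apply/andP; split; nra.
Qed.

Lemma hit_prob_down_le N j : hit_prob (toward_prob rho false) N j <= rho ^+ j.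
Proof.
case/andP: (rho01) => r0 r1.
apply: hit_prob_le; [exact: toward_prob01|exact: ltW|].
by rewrite /toward_prob; field; apply: lt0r_neq0; lra.
Qed.

Lemma hit_prob01 c N j : 0 <= hit_prob (toward_prob rho c) N j <= 1.
Proof.
have := toward_prob01 rho01 c => q01; rewrite hit_prob_ge0 //=.
have := @hit_prob_le R (toward_prob rho c) 1 N j q01 ler01; rewrite !expr1n; apply.
by ring.
Qed.

Lemma reached_prob k N : (P (reached k N) <= (weight * rho ^+ k)%:E)%E.
Proof.
case/andP: (rho01) => r0 r1.
rewrite /reached probability_setC; last exact: measurable_all_miss.
rewrite (all_miss_prob rho01 steps) ?uniq_frogs_before //.
rewrite -EFinB lee_fin.
have /andP[h _] := prod_onem_bounds (frogs_before N)
  (fun f => hit_prob01 false N (tag f + k)).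
apply: (@le_trans _ _ (\sum_(f <- frogs_before N) rho ^+ (tag f + k))).
  rewrite lerBlDr -lerBlDl; apply: le_trans h.
  by rewrite lerB //; apply: ler_sum => f _; exact: hit_prob_down_le.
rewrite /frogs_before big_allpairs_dep /=.
under eq_bigr => x _ do rewrite big_const_seq count_predT size_enum_ord iter_addr_0
  exprD -mulrnAl -mulr_natl.
rewrite -mulr_suml ler_wpM2r ?exprn_ge0 ?(ltW r0) //.
have := nondecreasing_cvgn_le _ eta_cvg N.
rewrite /series /= /index_iota subn0; apply.
by apply: nondecreasing_series => n _ _; rewrite mulr_ge0 ?exprn_ge0 // ltW.
Qed.

Lemma weight_ge0 : 0 <= weight.
Proof.
case/andP: (rho01) => r0 r1.
apply: limr_ge => //; apply: nearW => n; apply: sumr_ge0 => i _.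
by rewrite mulr_ge0 ?exprn_ge0 // ltW.
Qed.

Definition reached_ever k := \bigcup_N reached k N.

Lemma measurable_reached_ever k : measurable (reached_ever k).
Proof. by apply: bigcupT_measurable => N; exact: measurable_reached. Qed.

Lemma reached_nondecreasing k : nondecreasing_seq (reached k).
Proof.
move=> N N' le_N; apply/subsetPset => w; apply: contra_not => h.
apply/allP => f /allpairsPdep[x [i [xN iN fE]]].
apply/negP => /(hit_horizon le_N) h'.
have xN' : (x < N')%N by apply: leq_trans le_N; move: xN; rewrite mem_iota.
have fN' : f \in frogs_before N' by apply: mem_frogs_before; rewrite fE.
by move/allP: h => /(_ f fN') /negP.
Qed.

Lemma reached_ever_prob k : (P (reached_ever k) <= (weight * rho ^+ k)%:E)%E.
Proof.
have := @nondecreasing_cvg_mu _ _ _ P (reached k) (measurable_reached k)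
  (measurable_reached_ever k) (@reached_nondecreasing k).
move=> h; rewrite -(cvg_lim _ h) //; apply: lime_le; first exact: cvgP h.
by apply: nearW => N; exact: reached_prob.
Qed.

Lemma visited_reached_ever w z k :
  visited (bits w) z -> z <= - k%:Z -> reached_ever k w.
Proof.
move=> /visited_walk[f [n <-]] le_k.
(* This horizon covers [n] steps of [f], and its starting site, which has to lie strictly below the
   cutoff. *)
exists (maxn n (tag f).+1) => //= /allP.
move=> /(_ f (mem_frogs_before (leq_maxr _ _))) /negP; apply.
apply: (hit_horizon (leq_maxl n _)).
apply: (@walk_hit_down eta (bits w)); rewrite add0n walk0; apply: le_trans le_k _.
by lia.
Qed.

(** The one frog per site that is kept for the lower bound. *)
Definition first_frog x : frog eta := Tagged (fun x => 'I_(eta x)) (Ordinal (eta_gt0 x)).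

Lemma frog_X_le w n : (forall z, visited (bits w) z -> - n%:Z <= z) ->
  (frog_X step w <= n%:R%:E)%E.
Proof.
move=> h; rewrite /frog_X /neg_min leeNl -EFinN.
apply: le_ereal_inf_tmp => _ [z zv <-]; rewrite lee_fin.
have -> : - n%:R = (- n%:Z)%:~R :> R by rewrite rmorphN /=.
by rewrite ler_int; exact: h.
Qed.

Lemma frog_X_ge w k : visited (bits w) (- k%:Z) -> (k%:R%:E <= frog_X step w)%E.
Proof.
move=> h; rewrite /frog_X /neg_min leeNr -EFinN.
by apply: ereal_inf_lbound; exists (- k%:Z) => //; rewrite rmorphN.
Qed.

Lemma frog_X_ge0 w : (0 <= frog_X step w)%E.
Proof.
apply: (@frog_X_ge w 0%N); rewrite oppr0.
exists 0%N, (first_frog 0), 0%N; split; first exact: origin_awake.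
by rewrite walk0.
Qed.

Lemma frog_X_reached w :
  (exists2 n, (frog_X step w <= n%:R%:E)%E &
     forall k, (0 < k <= n)%N -> reached_ever k w) \/
  (forall k, reached_ever k w).
Proof.
have unbounded k : ~ (forall z, visited (bits w) z -> - k%:Z <= z) ->
    exists2 z, visited (bits w) z & z < - k%:Z.
  by move=> /existsNP[z /not_implyP[zv /negP]]; rewrite -ltNge; exists z.
have [[n hn]|nb] := pselect (exists n, forall z, visited (bits w) z -> - n%:Z <= z).
  left; pose B n := `[< forall z, visited (bits w) z -> - n%:Z <= z >].
  have exB : exists n, B n by exists n; exact/asboolP.
  (* By minimality of [n], each [k < n] leaves a visited site strictly below [- k], hence at or
     below [- k.+1]. *)
  case: (ex_minnP exB) => {hn}n /asboolP hn n_min.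
  exists n; first exact: frog_X_le.
  move=> [//|k] /andP[_ kn]; have [|z zv zk] := unbounded k.
    by move=> /asboolP /n_min; rewrite leqNgt kn.
  by apply: (visited_reached_ever zv); lia.
right => k; have [|z zv zk] := unbounded k; first by move=> h; apply: nb; exists k.
by apply: (visited_reached_ever zv); exact: ltW.
Qed.

Lemma frog_moment_le m K : (0 < m)%N -> (1 - rho)^-1 <= K.+1%:R ->
  (frog_moment step m <=
     (K.+1%:R ^+ m * (1 + weight * rho ^+ K * tail_const R m))%:E)%E.
Proof.
case/andP: (rho01) => r0 r1; move=> m0 uK.
apply: (moment_le _ weight_ge0 measurable_reached_ever reached_ever_prob
  frog_X_ge0 frog_X_reached) => //.
by rewrite (ltW r0).
Qed.

(** On its way to [L] the frog from the origin visits [x]. Steps are counted from activation, so the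
    descent of the frog at [x] does not depend on when it wakes up. *)
Lemma woken_hit_frog_X w k L N M x : (x < L)%N ->
  hit true (bits w (first_frog 0)) M 0 L ->
  hit false (bits w (first_frog x)) N 0 (x + k) ->
  (k%:R%:E <= frog_X step w)%E.
Proof.
move=> xL /(hit_nearer (ltnW xL)) /hit_up_walk[n1 e1] /hit_down_walk[n2 e2].
apply: frog_X_ge.
have aw : age (bits w) 0 (first_frog 0) = Some 0%N by exact: origin_awake.
have [|t [q /(@walk_visited _ _ _ _ _ n2)]] := visit_wakes aw (n := n1) (f := first_frog x).
  by rewrite e1 walk0 /= add0r.
by rewrite e2 walk0 /= (_ : _ - _ = - k%:Z) //; lia.
Qed.

(* The frog at the origin hitting [L] wakes up every frog starting below [L]. *)
Lemma frog_moment_ge_finite m k L N :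
  ((k%:R ^+ m * (hit_prob (toward_prob rho true) N L -
     \prod_(x < L) (1 - hit_prob (toward_prob rho false) N (x + k))))%:E <=
   frog_moment step m)%E.
Proof.
pose fs := map first_frog (iota 0 L).
have ufs : uniq fs by rewrite map_inj_uniq ?iota_uniq // => x y [].
pose D := all_miss step false N (fun f => tag f + k)%N fs.
pose U := miss step true N 0 L (first_frog 0).
have mD : measurable D by exact: measurable_all_miss.
have mU : measurable U by exact: measurable_miss.
have mG : measurable (~` (D `|` U)) by apply: measurableC; exact: measurableU.
have k0 : 0 <= k%:R ^+ m :> R by exact: exprn_ge0.
apply: (@le_trans _ _ (\int[P]_w ((k%:R ^+ m)%:E * (\1_(~` (D `|` U)) w)%:E))%E).
  have -> : (\int[P]_w ((k%:R ^+ m)%:E * (\1_(~` (D `|` U)) w)%:E) =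
      (k%:R ^+ m)%:E * P (~` (D `|` U)))%E.
    rewrite ge0_integralZl_EFin //; last first.
      by apply/measurable_EFinP; exact: measurable_indic.
    by rewrite integral_indic // setIT.
  rewrite EFinM; apply: lee_wpmul2l; first by rewrite lee_fin.
  rewrite probability_setC; last exact: measurableU.
  have PD : P D = (\prod_(x < L) (1 - hit_prob (toward_prob rho false) N (x + k)))%:E.
    rewrite (all_miss_prob rho01 steps _ _ _ ufs) big_map.
    by rewrite -[L in iota 0 L]subn0 -/(index_iota 0 L) big_mkord.
  have PU := miss_prob rho01 steps true N L (first_frog 0).
  (* The frog at the origin may enter both events, so subadditivity is used instead of independence;
     the loss [P U] vanishes as the horizon grows. *)
  have : (P (D `|` U) <= P D + P U)%E by exact: measureU2.
  rewrite PD PU -(fineK (fin_num_measure P _ (measurableU _ _ mD mU))) => h.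
  by rewrite -EFinB lee_fin; rewrite -EFinD lee_fin in h; lra.
apply: le_integral_nonneg => w; first by rewrite mule_ge0 ?lee_fin.
rewrite indicE; case: (boolP (w \in _)) => [|_]; last first.
  by rewrite mule0; apply: expe_ge0; exact: frog_X_ge0.
rewrite inE setCU => -[nD /negP]; rewrite negbK => hitU.
rewrite mule1 EFin_expe; apply: lee_expe; first by rewrite lee_fin.
move/negP: nD; rewrite -has_predC => /hasP[f /mapP[x]].
rewrite mem_iota add0n => /andP[_ xL] -> /=; rewrite negbK => hitD.
exact: (woken_hit_frog_X xL hitU hitD).
Qed.

End moment_bounds.

(** * Lower bound on the moments at fixed drift *)

Section moment_lower_bound.
Variables (R : realType) (rho : R).
Hypothesis rho01 : 0 < rho < 1.

(* The rate in [hit_prob_ge] for [gamma] = [sqrt rho] (downwards, [q / (1 - q)] = [rho])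
   and for [gamma] = [1 / sqrt rho] (upwards, [q / (1 - q)] = [1 / rho]). *)
Let beta := 2 * Num.sqrt rho / (1 + rho).

Let sqrtK : Num.sqrt rho ^+ 2 = rho.
Proof. by case/andP: rho01 => r0 r1; rewrite sqr_sqrtr // ltW. Qed.

Let sqrt01 : 0 < Num.sqrt rho < 1.
Proof.
case/andP: (rho01) => r0 r1; rewrite sqrtr_gt0 r0 /= -sqrtr1.
by rewrite ltr_sqrt.
Qed.

Let beta_ge0 : 0 <= beta.
Proof.
by case/andP: (rho01) => r0 r1; case/andP: sqrt01 => s0 s1; rewrite divr_ge0 //; lra.
Qed.

Let beta_cvg0 (x y : R) : y - beta ^+ N * x @[N --> \oo] --> y.
Proof.
case/andP: (rho01) => r0 r1; case/andP: sqrt01 => s0 s1.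
(* Arithmetic-geometric mean inequality for 1 and [rho], from [(1 - sqrt rho) ^ 2 > 0]. *)
have b1 : beta < 1.
  rewrite /beta ltr_pdivrMr ?mul1r; last lra.
  by have := exprn_gt0 2 (_ : 0 < 1 - Num.sqrt rho); rewrite subr_gt0 => /(_ s1);
    rewrite -[X in _ < 1 + X]sqrtK; lra.
rewrite -[X in _ --> X]subr0; apply: cvgB; first exact: cvg_cst.
rewrite -[X in _ --> X](mul0r x); apply: cvgMl.
by apply: cvg_expr; rewrite ger0_norm.
Qed.

Lemma hit_prob_down_cvg j : hit_prob (toward_prob rho false) N j @[N --> \oo] --> rho ^+ j.
Proof.
case/andP: (rho01) => r0 r1; case/andP: sqrt01 => s0 s1.
have n0 : 1 + rho != 0 by apply: lt0r_neq0; lra.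
apply: (squeeze_cvgr _ (@beta_cvg0 (Num.sqrt rho ^+ j) _) (cvg_cst _)).
apply: nearW => N; rewrite hit_prob_down_le // andbT.
apply: hit_prob_ge => //; first exact: toward_prob01.
- rewrite (ltW r0) -[leLHS]sqrtK expr2 ger_pMr //; exact: ltW.
- by rewrite /toward_prob; field.
- rewrite sqrtK /beta /toward_prob le_eqVlt; apply/orP; left; apply/eqP.
  rewrite [RHS](_ : _ = 2 * Num.sqrt rho ^+ 2 / (1 + rho)); last by field.
  by rewrite sqrtK; field.
Qed.

(** Upwards the relevant root is [r = 1], and [1 / sqrt rho] lies between the roots 1 and [1 / rho],
    which makes the correction decay. *)
Lemma hit_prob_up_cvg j : hit_prob (toward_prob rho true) N j @[N --> \oo] --> (1 : R).
Proof.
case/andP: (rho01) => r0 r1; case/andP: sqrt01 => s0 s1.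
have n0 : 1 + rho != 0 by apply: lt0r_neq0; lra.
apply: (squeeze_cvgr _ (@beta_cvg0 ((Num.sqrt rho)^-1 ^+ j) _) (cvg_cst _)).
apply: nearW => N; have /andP[_ ->] := hit_prob01 rho01 true N j; rewrite andbT.
rewrite -[X in X - _](expr1n R j); apply: hit_prob_ge => //; first exact: toward_prob01.
- by rewrite ler01 invf_ge1 // ltW.
- by rewrite /toward_prob; field.
- rewrite exprVn sqrtK /beta /toward_prob le_eqVlt; apply/orP; left; apply/eqP.
  by field; rewrite n0 !lt0r_neq0.
Qed.

(** With [S] the sum over the remaining factors, the induction rests on
    [(1 - h) * (1 + h + S) <= 1 + S]; this rational bound replaces the exponential one. *)
Lemma prod_onem_le (I : Type) (s : seq I) (h : I -> R) :
  (forall i, 0 <= h i <= 1) ->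
  \prod_(i <- s) (1 - h i) <= (1 + \sum_(i <- s) h i)^-1.
Proof.
move=> h01; elim: s => [|i s IH]; first by rewrite !big_nil addr0 invr1.
rewrite !big_cons; case/andP: (h01 i) => h0 h1.
have S0 : 0 <= \sum_(j <- s) h j by apply: sumr_ge0 => j _; case/andP: (h01 j).
apply: (@le_trans _ _ ((1 - h i) * (1 + \sum_(j <- s) h j)^-1)).
  by rewrite ler_wpM2l // subr_ge0.
rewrite ler_pdivrMr; last lra.
by rewrite mulrC ler_pdivlMr; [nra|lra].
Qed.

Variables (d : measure_display) (T : measurableType d).
Variables (P : probability T R) (eta : nat -> nat).
Variable step : frog eta -> nat -> {RV P >-> bool}.
Hypothesis steps : frog_steps rho step.
Hypothesis eta_gt0 : forall x, (0 < eta x)%N.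

(** First [N] tends to infinity with [L] fixed, so that the frog from the origin reaches [L] with
    probability tending to 1; then [L] does, and the sum becomes a full geometric series. *)
Lemma frog_moment_ge m k :
  ((k%:R ^+ m * (1 - (1 + rho ^+ k / (1 - rho))^-1))%:E <= frog_moment step m)%E.
Proof.
case/andP: (rho01) => r0 r1.
have finite L N : ((k%:R ^+ m * (hit_prob (toward_prob rho true) N L -
    (1 + \sum_(x < L) hit_prob (toward_prob rho false) N (x + k))^-1))%:E <=
    frog_moment step m)%E.
  apply: le_trans (frog_moment_ge_finite rho01 steps eta_gt0 m k L N).
  rewrite lee_fin ler_wpM2l ?exprn_ge0 // lerB //; apply: prod_onem_le => x.
  exact: hit_prob01.
case: (frog_moment step m) finite => [F| |] finite; last 2 first.
- by rewrite leey.
- by have := finite 0%N 0%N.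
rewrite lee_fin.
have cvg_le (u : R^nat) l : u @ \oo --> l -> (forall n, u n <= F) -> l <= F.
  move=> ul uF; rewrite -(cvg_lim _ ul) //; apply: limr_le; first exact: cvgP ul.
  exact: nearW.
have geo (L : nat) : 0 <= \sum_(x < L) rho ^+ (x + k).
  by apply: sumr_ge0 => x _; rewrite exprn_ge0 // ltW.
have fixedL L : k%:R ^+ m * (1 - (1 + \sum_(x < L) rho ^+ (x + k))^-1) <= F.
  apply: cvg_le (fun N => finite L N); apply: cvgMr; apply: cvgB; first exact: hit_prob_up_cvg.
  apply: cvgV; first by apply: lt0r_neq0; have := geo L; lra.
  apply: cvgD; first exact: cvg_cst.
  by apply: cvg_big => [|x _]; [exact: add_continuous|exact: hit_prob_down_cvg].
apply: cvg_le fixedL; apply: cvgMr; apply: cvgB; first exact: cvg_cst.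
apply: cvgV.
  by apply: lt0r_neq0; have : 0 < rho ^+ k / (1 - rho); [
    rewrite divr_gt0 ?exprn_gt0 //; lra|lra].
apply: cvgD; first exact: cvg_cst.
have -> : (fun L => \sum_(x < L) rho ^+ (x + k)) = series (geometric (rho ^+ k) rho).
  apply/funext => L; rewrite /series /= big_mkord; apply: eq_bigr => x _.
  by rewrite addnC exprD.
by apply: cvg_geometric_series; rewrite ger0_norm // ltW.
Qed.

End moment_lower_bound.

(** * Asymptotics as the drift parameter tends to 1 *)

Section asymptotics.
Variable R : realType.
Implicit Types (rho c : R) (m : nat).

Lemma near_left1 : \forall rho \near (1 : R)^'-, 0 < rho < 1.
Proof.
near=> rho; apply/andP; split; near: rho; last exact: nbhs_left_lt.
by apply: nbhs_left_gt; exact: ltr01.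
Unshelve. all: by end_near. Qed.

Lemma near_ln_large (Y : R) : \forall rho \near (1 : R)^'-, Y <= - ln (1 - rho).
Proof.
near=> rho.
have /andP[r0 r1] : 0 < rho < 1 by near: rho; exact: near_left1.
have rY : 1 - expR (- Y) < rho.
  by near: rho; apply: nbhs_left_gt; have := expR_gt0 (- Y); lra.
rewrite lerNr -[leRHS]expRK ler_ln ?posrE ?expR_gt0 //; lra.
Unshelve. all: by end_near. Qed.

(** From [ln y <= y - 1] at [y = 1 / rho], that is, [- ln rho <= (1 - rho) / rho]. *)
Lemma frog_Z_ge rho : 0 < rho < 1 -> rho * (1 - rho)^-1 * - ln (1 - rho) <= frog_Z rho.
Proof.
case/andP=> r0 r1; have l1 : ln rho < 0 by rewrite ln_lt0 // r0.
have l2 : ln (1 - rho) < 0 by rewrite ln_lt0 //; lra.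
have : - ln rho <= (1 - rho) / rho.
  have := expR_ge1Dx (- ln rho); rewrite expRN lnK ?posrE // => h.
  have -> : (1 - rho) / rho = rho^-1 - 1 by field; rewrite lt0r_neq0.
  by lra.
rewrite ler_pdivlMr // => h.
rewrite /frog_Z -[leRHS]mulrNN -invrN ler_pdivlMr ?oppr_gt0 // -mulrA mulrCA.
have h1 : 0 < 1 - rho by lra.
rewrite -[leRHS]mul1r [leLHS](_ : _ = (- ln rho * rho) / (1 - rho) * - ln (1 - rho)).
  by rewrite ler_wpM2r ?oppr_ge0 ?(ltW l2) // ler_pdivrMr // mul1r.
by ring.
Qed.

Lemma near_frog_Z_ge (B : R) : 0 <= B ->
  \forall rho \near (1 : R)^'-, B * (1 - rho)^-1 <= frog_Z rho.
Proof.
move=> B0; near=> rho.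
have r01 : 0 < rho < 1 by near: rho; exact: near_left1.
have half : 2^-1 < rho by near: rho; apply: nbhs_left_gt; lra.
have large : 2 * B <= - ln (1 - rho) by near: rho; exact: near_ln_large.
apply: le_trans (frog_Z_ge r01); rewrite mulrAC ler_wpM2r //.
  by rewrite invr_ge0; lra.
have : 2^-1 * (2 * B) <= rho * - ln (1 - rho) by apply: ler_pM => //; lra.
by lra.
Unshelve. all: by end_near. Qed.

Lemma frog_Z_ln rho : 0 < rho < 1 -> frog_Z rho * ln rho = ln (1 - rho).
Proof.
by case/andP=> r0 r1; rewrite mulfVK // ltr0_neq0 // ln_lt0 // r0.
Qed.

Lemma expr_expR rho k : 0 < rho -> rho ^+ k = expR (k%:R * ln rho).
Proof. by move=> r0; rewrite mulrC expRM_natr lnK. Qed.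

(** [frog_Z rho] is the exponent at which [rho] becomes [1 - rho], and powers of [rho] decrease with
    the exponent. *)
Lemma expr_frog_Z_le rho (a : R) k : 0 < rho < 1 ->
  a * frog_Z rho <= k%:R -> rho ^+ k <= (1 - rho) `^ a.
Proof.
move=> /[dup] r01 /andP[r0 r1] ak.
have l1 : ln rho < 0 by rewrite ln_lt0 // r0.
rewrite expr_expR // /powR gt_eqF ?subr_gt0 // ler_expR -frog_Z_ln // mulrA.
by rewrite ler_wnM2r // ltW.
Qed.

Lemma expr_frog_Z_ge rho (a : R) k : 0 < rho < 1 ->
  k%:R <= a * frog_Z rho -> (1 - rho) `^ a <= rho ^+ k.
Proof.
move=> /[dup] r01 /andP[r0 r1] ak.
have l1 : ln rho < 0 by rewrite ln_lt0 // r0.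
rewrite expr_expR // /powR gt_eqF ?subr_gt0 // ler_expR -frog_Z_ln // mulrA.
by rewrite ler_wnM2r // ltW.
Qed.

Lemma root_of_pos (y : R) m : 0 < y -> exists2 c, 0 < c & c ^+ m.+1 = y.
Proof.
move=> y0; exists (expR (ln y / m.+1%:R)); first exact: expR_gt0.
by rewrite -expRM_natr -mulrA mulVf ?mulr1 ?lnK ?posrE // pnatr_eq0.
Qed.

Lemma mul_le_of_le_div (x y z : R) : 0 <= x -> 0 <= y -> x <= z / (1 + y) -> x * y <= z.
Proof.
move=> x0 y0; rewrite ler_pdivlMr; last lra.
by apply: le_trans; rewrite mulrDr mulr1 lerDr.
Qed.

Lemma le_onem_inv (c y : R) : c < 1 -> (1 - c)^-1 <= y -> c <= 1 - (1 + y)^-1.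
Proof.
move=> c1 cy; have ic0 : 0 < (1 - c)^-1 by rewrite invr_gt0 subr_gt0.
have : (1 + y)^-1 <= 1 - c by rewrite -[leRHS]invrK lef_pV2 ?posrE //; lra.
by lra.
Qed.

Variable eta : nat -> nat.
Hypothesis eta_H : frog_distribution R eta.
Hypothesis eta_lim : forall delta : R, 0 < delta ->
  (1 - rho) `^ (1 + delta) *
    limn (series (fun k => (eta k)%:R * rho ^+ k))
  @[rho --> (1 : R)^'-] --> (0 : R).
Variables (d : R -> measure_display) (T : forall rho, measurableType (d rho)).
Variable P : forall rho, probability (T rho) R.
Variable step : forall rho, frog eta -> nat -> {RV (P rho) >-> bool}.
Hypothesis step_walks : forall rho, 0 < rho < 1 -> frog_steps rho (step rho).

(** Of the [m.+1] factors [c], [m] absorb the ratio of [K.+1] to [frog_Z rho] and the last absorbs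
    the tail term. *)
Lemma near_frog_moment_le c m : 1 < c -> (0 < m)%N ->
  \forall rho \near (1 : R)^'-,
    (frog_moment (step rho) m <= (c ^+ m.+1 * frog_Z rho ^+ m)%:E)%E.
Proof.
(* Thus [c = 1 + 2 * delta]: one [delta] makes the tail small, the other pays for rounding [K.+1]
   up. *)
move=> c1 m0; pose delta := (c - 1) / 2.
have delta0 : 0 < delta by rewrite /delta; lra.
have C0 := tail_const_ge0 R m.
near=> rho.
have r01 : 0 < rho < 1 by near: rho; exact: near_left1.
have /andP[r0 r1] := r01.
have u1 : 1 <= (1 - rho)^-1 by rewrite invf_ge1; lra.
have Zu : (1 - rho)^-1 <= frog_Z rho.
  by rewrite -[leLHS]mul1r; near: rho; exact: near_frog_Z_ge.
have Zbig : 2 / delta * (1 - rho)^-1 <= frog_Z rho.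
  by near: rho; apply: near_frog_Z_ge; rewrite divr_ge0 // ltW.
(* The threshold is chosen so that multiplying by [tail_const R m] leaves at most [c - 1]. *)
have small : (1 - rho) `^ (1 + delta) *
    limn (series (fun k => (eta k)%:R * rho ^+ k)) <= (c - 1) / (1 + tail_const R m).
  near: rho; have /cvgr_le := eta_lim delta0; apply.
  by rewrite divr_gt0; lra.
set A := limn _ in small.
have A0 : 0 <= A := weight_ge0 r01 (eta_H.2 _ r01).
have Z0 : 0 <= frog_Z rho by lra.
have dZ : 2 <= delta * frog_Z rho.
  rewrite mulrC -ler_pdivrMr //; apply: le_trans Zbig.
  by rewrite ler_peMr // divr_ge0 // ltW.
pose K := (Num.truncn ((1 + delta) * frog_Z rho)).+1.
have K_gt : (1 + delta) * frog_Z rho < K%:R by exact: truncnS_gt.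
have K_le : K%:R <= (1 + delta) * frog_Z rho + 1.
  by rewrite -natr1 lerD2r truncn_le mulr_ge0 //; lra.
have cZ : c * frog_Z rho = frog_Z rho + 2 * (delta * frog_Z rho).
  by rewrite /delta; field.
have uK : (1 - rho)^-1 <= K.+1%:R by rewrite -natr1; lra.
apply: le_trans
  (frog_moment_le r01 (step_walks r01) eta_H.1 (eta_H.2 _ r01) m0 uK) _.
rewrite lee_fin [c ^+ _]exprSr [leRHS]mulrAC -[in leRHS]exprMn; apply: ler_pM.
- exact: exprn_ge0.
- by rewrite addr_ge0 // !mulr_ge0 // exprn_ge0 // ltW.
- rewrite lerXn2r ?nnegrE //; first by rewrite mulr_ge0 //; lra.
  by rewrite -natr1 cZ; lra.
have AK : A * rho ^+ K <= (c - 1) / (1 + tail_const R m).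
  apply: le_trans small; rewrite mulrC ler_wpM2r //.
  by apply: expr_frog_Z_le => //; exact: ltW.
have := @mul_le_of_le_div (A * rho ^+ K) (tail_const R m) (c - 1).
rewrite lerBrDl; apply => //.
by rewrite mulr_ge0 // exprn_ge0 // ltW.
Unshelve. all: by end_near. Qed.

(** Here [m] factors [c] absorb the ratio of [k] to [frog_Z rho], and the last one bounds from below
    the probability of getting down to [- k]. *)
Lemma near_frog_moment_ge c m : 0 < c < 1 ->
  \forall rho \near (1 : R)^'-,
    ((c ^+ m.+1 * frog_Z rho ^+ m)%:E <= frog_moment (step rho) m)%E.
Proof.
case/andP=> c0 c1; pose delta := (1 - c) / 2.
have delta0 : 0 < delta by rewrite /delta; lra.
have delta1 : delta < 1 by rewrite /delta; lra.
near=> rho.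
have r01 : 0 < rho < 1 by near: rho; exact: near_left1.
have /andP[r0 r1] := r01.
have u1 : 1 <= (1 - rho)^-1 by rewrite invf_ge1; lra.
have Zbig : delta^-1 * (1 - rho)^-1 <= frog_Z rho.
  by near: rho; apply: near_frog_Z_ge; rewrite invr_ge0 ltW.
have dZ : 1 <= delta * frog_Z rho.
  rewrite mulrC -ler_pdivrMr // mul1r; apply: le_trans Zbig.
  by rewrite ler_peMr // invr_ge0 ltW.
have Z0 : 0 <= frog_Z rho by rewrite -(pmulr_rge0 _ delta0); exact: le_trans dZ.
have large : (1 - c)^-1 / delta <= - ln (1 - rho) by near: rho; exact: near_ln_large.
have cZ : c * frog_Z rho = frog_Z rho - 2 * (delta * frog_Z rho).
  by rewrite /delta; field.
pose k := Num.truncn ((1 - delta) * frog_Z rho).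
have k_le : k%:R <= (1 - delta) * frog_Z rho.
  by rewrite truncn_le mulr_ge0 //; lra.
have k_gt : (1 - delta) * frog_Z rho < k%:R + 1 by rewrite natr1; exact: truncnS_gt.
apply: le_trans (frog_moment_ge r01 (step_walks r01) eta_H.1 m k).
rewrite lee_fin [c ^+ _]exprSr [leLHS]mulrAC -[in leLHS]exprMn; apply: ler_pM.
- by rewrite exprn_ge0 // mulr_ge0 // ltW.
- exact: ltW.
- rewrite lerXn2r ?nnegrE //; first by rewrite mulr_ge0 // ltW.
  by rewrite cZ; lra.
(* The quotient is at least [(1 - rho)] to the power [- delta], which diverges; [large] fixes how
   close to 1 the drift has to be. *)
have y_ge : (1 - c)^-1 <= rho ^+ k / (1 - rho).
  apply: (@le_trans _ _ ((1 - rho) `^ (1 - delta) / (1 - rho))); last first.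
    rewrite ler_wpM2r ?invr_ge0 ?subr_ge0 ?(ltW r1) //.
    exact: expr_frog_Z_ge.
  have -> : (1 - rho) `^ (1 - delta) / (1 - rho) = expR (delta * - ln (1 - rho)).
    rewrite /powR gt_eqF ?subr_gt0 // -[X in _ / X]lnK ?posrE ?subr_gt0 //.
    by rewrite -expRN -expRD; congr expR; ring.
  rewrite ler_pdivrMr // mulrC in large.
  by have := expR_ge1Dx (delta * - ln (1 - rho)); lra.
by apply: le_onem_inv y_ge.
Unshelve. all: by end_near. Qed.

Lemma frog_moment_cvg m : (0 < m)%N ->
  (frog_moment (step rho) m / (frog_Z rho ^+ m)%:E)%E
    @[rho --> (1 : R)^'-] --> (1%:E : \bar R).
Proof.
move=> m0.
have close e : 0 < e -> \forall rho \near (1 : R)^'-,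
    exists2 x, (frog_moment (step rho) m / (frog_Z rho ^+ m)%:E)%E = x%:E &
               `|1 - x| <= e.
  (* The cap at 1/2 keeps [1 - e'] positive, so that it has an [m.+1]-st root to serve as [c] in the
     lower bound. *)
  move=> e0; pose e' := Num.min e (1 / 2).
  have e'0 : 0 < e' by rewrite lt_min e0; lra.
  have e'1 : e' <= 1 / 2 by rewrite ge_min lexx orbT.
  have e'e : e' <= e by rewrite ge_min lexx.
  have [a a0 ea] : exists2 a, 0 < a & a ^+ m.+1 = 1 - e' by apply: root_of_pos; lra.
  have [b b0 eb] : exists2 b, 0 < b & b ^+ m.+1 = 1 + e' by apply: root_of_pos; lra.
  have a1 : a < 1 by rewrite -(@expr_lt1 _ m.+1) ?ltW // ea; lra.
  have b1 : 1 < b by rewrite -(@expr_gt1 _ m.+1) ?ltW // eb; lra.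
  near=> rho.
  have /andP[r0 r1] : 0 < rho < 1 by near: rho; exact: near_left1.
  have Z1 : 1 * (1 - rho)^-1 <= frog_Z rho by near: rho; exact: near_frog_Z_ge.
  have Z0 : 0 < frog_Z rho by apply: lt_le_trans Z1; rewrite mul1r invr_gt0; lra.
  have Zm0 : 0 < frog_Z rho ^+ m by exact: exprn_gt0.
  have : (frog_moment (step rho) m <= (b ^+ m.+1 * frog_Z rho ^+ m)%:E)%E.
    by near: rho; exact: near_frog_moment_le.
  have : ((a ^+ m.+1 * frog_Z rho ^+ m)%:E <= frog_moment (step rho) m)%E.
    by near: rho; apply: near_frog_moment_ge; rewrite a0.
  case: (frog_moment (step rho) m) => [F| |] //; rewrite !lee_fin ea eb => lo hi.
  exists (F / frog_Z rho ^+ m); first by rewrite inver gt_eqF.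
  rewrite distrC ler_norml; apply/andP; split.
    rewrite lerBrDl ler_pdivlMr //; apply: le_trans lo.
    by rewrite ler_wpM2r ?(ltW Zm0) // lerB.
  rewrite lerBlDl ler_pdivrMr //; apply: (le_trans hi).
  by rewrite ler_wpM2r ?(ltW Zm0) // lerD2l.
(* Convergence in the extended reals: the ratio is eventually finite, and its real value
   converges. *)
apply/fine_cvgP; split.
  by apply: filterS (close 1 ltr01) => rho [x -> _].
apply/cvgrPdist_le => e e0.
by apply: filterS (close e e0) => rho [x xE]; rewrite /= xE.
Unshelve. all: by end_near. Qed.

End asymptotics.

Theorem theorem1 (R : realType) (eta : nat -> nat)
  (eta_H : frog_distribution R eta)
  (eta_lim : forall delta : R, 0 < delta ->
     (1 - rho) `^ (1 + delta) *
       limn (series (fun k => (eta k)%:R * rho ^+ k))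
     @[rho --> (1 : R)^'-] --> (0 : R))
  (d : R -> measure_display)
  (T : forall rho : R, measurableType (d rho))
  (P : forall rho : R, probability (T rho) R)
  (step : forall rho : R, frog eta -> nat -> {RV (P rho) >-> bool})
  (step_walks : forall rho : R, 0 < rho < 1 -> frog_steps rho (step rho))
  (m : nat) (m_gt0 : (0 < m)%N) :
  (frog_moment (step rho) m / (frog_Z rho ^+ m)%:E)%E
    @[rho --> (1 : R)^'-] --> (1%:E : \bar R).
Proof. exact: frog_moment_cvg. Qed.
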